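(* Let $\mathcal R$ be a class of functions $\mathcal X\to(0,\infty)$. Assume that $H_0^{\mathcal R}$ is true, i.e. there exists $r_\star\in\mathcal R$ such that $g\propto r_\star f$, and let $r_\star$ be such a function. Let $\hat r:\mathcal X\to(0,\infty)$ be a deterministic approximation of $r_\star$ with $\int\hat r f\,d\mu<\infty$, let $T:\mathcal X^{n+m}\to\mathbb R$ be a deterministic test statistic, and let $p_{\hat r}$ be the output of the density ratio permutation test run with $\hat r$ as the density ratio, with fixed parameters $S\ge1$, $H\ge1$ and initialized at the identity permutation. Writing $\check r=(\int\hat r f\,d\mu)^{-1}\hat r$ and $\bar r_\star=(\int r_\star f\,d\mu)^{-1}r_\star$, for all $\alpha\in[0,1]$ we have $$\mathbb P\{p_{\hat r}\le\alpha\}\le\alpha+\mathrm{TV}\bigl(\{\check r f\}^{\otimes m},\{\bar r_\star f\}^{\otimes m}\bigr).$$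
   Context: Setting. $\mathcal X$ is a sample space with dominating measure $\mu$; $f,g$ are probability densities with respect to $\mu$. For $n,m\ge1$ one observes $Z=(Z_1,\ldots,Z_{n+m})=(X_1,\ldots,X_n,Y_1,\ldots,Y_m)$, with all variables independent, $X_i\sim f$, $Y_j\sim g$. $g\propto r_\star f$ means $g=r_\star f/\int r_\star f\,d\mu$ with $\int r_\star f\,d\mu<\infty$. $\mathrm{TV}(P_1,P_2)=\sup_A|P_1(A)-P_2(A)|$; $\{q\}^{\otimes m}$ is the $m$-fold product of the law with density $q$. $x_\sigma:=(x_{\sigma(1)},\ldots,x_{\sigma(n+m)})$. Pairwise sampler based on a function $r:\mathcal X\to(0,\infty)$. Let $K=\min\{n,m\}$. Given $\sigma_{t-1}$ (and $Z$), $\sigma_t$ is obtained as follows: sample $(i_1^t,\ldots,i_K^t)$ uniformly without replacement from $[n]$ and (independently) $(j_1^t,\ldots,j_K^t)$ uniformly without replacement from $\{n+1,\ldots,n+m\}$; initialize $\sigma_t$ as a copy of $\sigma_{t-1}$; for each $k\in[K]$, independently, swap the values $\sigma_t(i_k^t)$ and $\sigma_t(j_k^t)$ with probability $r(Z_{\sigma_{t-1}(i_k^t)})/\{r(Z_{\sigma_{t-1}(i_k^t)})+r(Z_{\sigma_{t-1}(j_k^t)})\}$. Density ratio permutation test based on $r$. Let $\sigma_*$ be the output of the pairwise sampler after $S$ steps started at the initial permutation $\sigma_0$. Conditionally on $\sigma_*$ and $Z$, independently for each $h\in[H]$, let $\sigma^{(h)}$ be the output of the pairwise sampler after $S$ steps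 started at $\sigma_*$. Put $Z^{(h)}=Z_{\sigma^{(h)}}$ and return $p=(1+H)^{-1}\bigl(1+\sum_{h=1}^H\mathbb 1\{T(Z^{(h)})\ge T(Z)\}\bigr)$. *)

(* Defs.v *)
From HB Require Import structures.
From mathcomp Require Import all_boot all_order all_algebra all_fingroup.
From mathcomp Require Import all_classical all_reals all_analysis measurable_realfun.

Set Implicit Arguments.
Unset Strict Implicit.
Unset Printing Implicit Defensive.
Import Order.TTheory GRing.Theory Num.Theory.
Import numFieldNormedType.Exports.

Local Open Scope classical_set_scope.
Local Open Scope ring_scope.

Record density (d : measure_display) (X : measurableType d) (R : realType)
    (mu : {measure set X -> \bar R}) := Density {
  pdf :> X -> R;
  measurable_pdf : measurable_fun [set: X] pdf;
  pdf_ge0 : forall x, 0 <= pdf x;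
  integral_pdf : (\int[mu]_x (pdf x)%:E = 1)%E
}.

Record posfun (d : measure_display) (X : measurableType d) (R : realType) :=
  PosFun {
  pos_fun :> X -> R;
  measurable_pos_fun : measurable_fun [set: X] pos_fun;
  pos_fun_gt0 : forall x, 0 < pos_fun x
}.

Section density_law.
Context {d : measure_display} {X : measurableType d} {R : realType}
  {mu : {measure set X -> \bar R}}.
Local Open Scope ereal_scope.

Definition density_law (q : density mu) (A : set X) : \bar R :=
  \int[mu]_(x in A) (q x)%:E.

Variable q : density mu.

Let density_law0 : density_law q set0 = 0.
Proof. exact: integral_set0. Qed.

Let density_law_ge0 A : 0 <= density_law q A.
Proof. by apply: integral_ge0 => x _; rewrite lee_fin pdf_ge0. Qed.

Let density_law_sigma_additive : semi_sigma_additive (density_law q).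
Proof.
apply: semi_sigma_additive_nng_induced => [|x].
  by apply/measurable_EFinP; exact: measurable_pdf.
by rewrite lee_fin pdf_ge0.
Qed.

HB.instance Definition _ := isMeasure.Build _ _ _ (density_law q)
  density_law0 density_law_ge0 density_law_sigma_additive.

Let density_law_setT : density_law q [set: X] = 1.
Proof. exact: integral_pdf. Qed.

HB.instance Definition _ := Measure_isProbability.Build _ _ _ (density_law q)
  density_law_setT.

End density_law.

Section tilt.
Context {d : measure_display} {X : measurableType d} {R : realType}
  {mu : {measure set X -> \bar R}}.
Variables (f : density mu) (r : posfun X R).

Definition tilt_mass : \bar R := (\int[mu]_x (r x * f x)%:E)%E.

Lemma measurable_tilt : measurable_fun [set: X] (fun x => r x * f x).
Proof.
by apply: measurable_funM; [exact: measurable_pos_fun|exact: measurable_pdf].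
Qed.

Lemma tilt_ge0 x : 0 <= r x * f x.
Proof. by rewrite mulr_ge0 ?pdf_ge0// ltW// pos_fun_gt0. Qed.

Lemma tilt_mass_gt0 : (0 < tilt_mass)%E.
Proof.
rewrite lt0e; apply/andP; split; last first.
  by apply: integral_ge0 => x _; rewrite lee_fin tilt_ge0.
apply/eqP => m0.
have /(ae_eq_integral_abs _ measurableT) : (\int[mu]_x `|(r x * f x)%:E| = 0)%E.
  by rewrite -[RHS]m0; apply: eq_integral => x _; rewrite gee0_abs// lee_fin tilt_ge0.
move=> /(_ ((measurable_EFinP _ _).2 measurable_tilt)) rf0.
have f0 : ae_eq mu setT (fun x => (f x)%:E) (cst 0%E).
  apply: filterS rf0 => x /= /(_ Logic.I)[] /eqP.
  by rewrite mulf_eq0 gt_eqF ?pos_fun_gt0//= => /eqP ->.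
have := integral_pdf f.
rewrite (ae_eq_integral (cst 0%E) _ measurableT _ _ f0)//.
  by rewrite integral0 => /eqP; rewrite eq_sym onee_eq0.
by apply/measurable_EFinP; exact: measurable_pdf.
Qed.

Hypothesis tilt_fin : (tilt_mass < +oo)%E.

Definition tilt_pdf (x : X) : R := (fine tilt_mass)^-1 * r x * f x.

Lemma measurable_tilt_pdf : measurable_fun [set: X] tilt_pdf.
Proof.
rewrite (_ : tilt_pdf = (fun x => (fine tilt_mass)^-1 * (r x * f x))).
  by apply: measurable_funM => //; exact: measurable_tilt.
by apply/funext => x; rewrite /tilt_pdf mulrA.
Qed.

Lemma tilt_pdf_ge0 x : 0 <= tilt_pdf x.
Proof.
by rewrite /tilt_pdf -mulrA mulr_ge0 ?tilt_ge0// invr_ge0 fine_ge0// ltW// tilt_mass_gt0.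
Qed.

Lemma integral_tilt_pdf : (\int[mu]_x (tilt_pdf x)%:E = 1)%E.
Proof.
have m_gt0 : 0 < fine tilt_mass by rewrite fine_gt0// tilt_mass_gt0.
under eq_integral do rewrite /tilt_pdf -mulrA EFinM.
rewrite ge0_integralZl//=.
- rewrite -/tilt_mass -{2}(@fineK _ tilt_mass) -?EFinM ?mulVf ?gt_eqF//.
  by rewrite ge0_fin_numE// ltW// tilt_mass_gt0.
- by apply/measurable_EFinP; exact: measurable_tilt.
- by move=> x _; rewrite lee_fin tilt_ge0.
- by rewrite lee_fin invr_ge0 ltW.
Qed.

Definition tilt : density mu :=
  Density measurable_tilt_pdf tilt_pdf_ge0 integral_tilt_pdf.

End tilt.
Arguments tilt {d X R mu} f r tilt_fin.

Section product_law.
Context {d : measure_display} {X : measurableType d} {R : realType}.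

Definition cons_pair (n : nat) (xt : X * n.-tuple X) : n.+1.-tuple X :=
  [tuple of xt.1 :: xt.2].

Lemma measurable_cons_pair n : measurable_fun setT (@cons_pair n).
Proof. by apply: measurable_cons. Qed.

HB.instance Definition _ n :=
  isMeasurableFun.Build _ _ _ _ (@cons_pair n) (@measurable_cons_pair n).

Fixpoint product_law (P : probability X R) (n : nat) :
    probability (n.-tuple X) R :=
  match n with
  | 0 => dirac [tuple]
  | n'.+1 => distribution (P \x product_law P n')%E (@cons_pair n')
  end.

End product_law.

Definition TV (d : measure_display) (T : measurableType d) (R : realType)
    (P1 P2 : probability T R) : \bar R :=
  ereal_sup [set `|P1 A - P2 A|%E | A in measurable].

(* The product rule over all subfamilies of the coordinates. *)
Definition independent_coords (dO d : measure_display)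
    (Omega : measurableType dO) (X : measurableType d) (R : realType)
    (P : probability Omega R) (N : nat) (Z : {RV P >-> N.-tuple X}) : Prop :=
  forall (J : {set 'I_N}) (A : 'I_N -> set X),
    (forall i, measurable (A i)) ->
    P [set w | forall i, i \in J -> A i (tnth (Z w) i)] =
    (\prod_(i in J) P [set w | A i (tnth (Z w) i)])%E.

(* The first n coordinates are X_1, ..., X_n, the last m are Y_1, ..., Y_m. *)
Definition two_sample (dO d : measure_display)
    (Omega : measurableType dO) (X : measurableType d) (R : realType)
    (mu : {measure set X -> \bar R}) (f g : density mu)
    (P : probability Omega R) (n m : nat) (Z : {RV P >-> (n + m).-tuple X}) :
    Prop :=
  [/\ independent_coords Z,
      forall (i : 'I_n) (A : set X), measurable A ->
        P [set w | A (tnth (Z w) (lshift m i))] = density_law f A &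
      forall (j : 'I_m) (A : set X), measurable A ->
        P [set w | A (tnth (Z w) (rshift n j))] = density_law g A].

Definition permute (X : Type) (N : nat) (z : N.-tuple X) (s : 'S_N) :
  N.-tuple X := [tuple tnth z (s i) | i < N].

Section pairwise_sampler.
Context {X : Type} {R : realType} {n m : nat}.
Variables (r : X -> R) (z : (n + m).-tuple X).

Local Notation K := (minn n m).

(* Ordered samples of K indices without replacement. *)
Definition draws (N : nat) : {set {ffun 'I_K -> 'I_N}} :=
  [set i : {ffun 'I_K -> 'I_N} | injectiveb i].

Definition swap_prob (s : 'S_(n + m)) (a b : 'I_(n + m)) : R :=
  r (tnth z (s a)) / (r (tnth z (s a)) + r (tnth z (s b))).

(* In 'S_N, (t * s) x = s (t x), so multiplying s on the left by tperm a b
   exchanges the values s a and s b.  The transpositions below have disjoint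
   supports, so their order is irrelevant. *)
Definition swap_pairs (i : {ffun 'I_K -> 'I_n}) (j : {ffun 'I_K -> 'I_m})
    (b : {ffun 'I_K -> bool}) (s : 'S_(n + m)) : 'S_(n + m) :=
  ((\prod_(k < K)
      (if b k then tperm (lshift m (i k)) (rshift n (j k)) else 1)) * s)%g.

(* Probability that the independent swap decisions are given by b. *)
Definition swaps_prob (i : {ffun 'I_K -> 'I_n}) (j : {ffun 'I_K -> 'I_m})
    (b : {ffun 'I_K -> bool}) (s : 'S_(n + m)) : R :=
  \prod_(k < K)
    (let p := swap_prob s (lshift m (i k)) (rshift n (j k)) in
     if b k then p else 1 - p).

Definition pairwise_step (s t : 'S_(n + m)) : R :=
  (#|draws n|%:R)^-1 * (#|draws m|%:R)^-1 *
  \sum_(i in draws n) \sum_(j in draws m) \sum_(b : {ffun 'I_K -> bool})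
    swaps_prob i j b s * (swap_pairs i j b s == t)%:R.

Fixpoint pairwise_sampler (S : nat) (s t : 'S_(n + m)) : R :=
  match S with
  | 0 => (s == t)%:R
  | S'.+1 => \sum_(u : 'S_(n + m)) pairwise_sampler S' s u * pairwise_step u t
  end.

(* Conditional joint mass function given Z = z of the hub permutation s (the
   output sigma_* of the first run) and of ss = (sigma^(1), ..., sigma^(H)). *)
Definition drpt_pmf (S H : nat) (s0 s : 'S_(n + m))
    (ss : 'I_H -> 'S_(n + m)) : R :=
  pairwise_sampler S s0 s * \prod_(h < H) pairwise_sampler S s (ss h).

End pairwise_sampler.

(* (sigma_*, sigma^(1), ..., sigma^(H)) are random permutations whose
   conditional law given Z is drpt_pmf. *)
Definition drpt_run (dO d : measure_display)
    (Omega : measurableType dO) (X : measurableType d) (R : realType)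
    (P : probability Omega R) (n m : nat) (Z : {RV P >-> (n + m).-tuple X})
    (r : X -> R) (S H : nat) (s0 : 'S_(n + m))
    (sigma_star : Omega -> 'S_(n + m)) (sigma : 'I_H -> Omega -> 'S_(n + m)) :
    Prop :=
  [/\ forall s, measurable [set w | sigma_star w = s],
      forall h s, measurable [set w | sigma h w = s] &
      forall (B : set ((n + m).-tuple X)) s (ss : 'I_H -> 'S_(n + m)),
        measurable B ->
        P [set w | [/\ B (Z w), sigma_star w = s & forall h, sigma h w = ss h]]
        = (\int[P]_(w in [set w | B (Z w)]) (drpt_pmf r (Z w) S s0 s ss)%:E)%E].

Definition drpt_pvalue (X : Type) (R : realType) (N H : nat)
    (T : N.-tuple X -> R) (z : N.-tuple X) (ss : 'I_H -> 'S_N) : R :=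
  (1 + H%:R)^-1 * (1 + \sum_(h < H) (T z <= T (permute z (ss h)))%R%:R).

(* Main.v *)
Require Import Defs.
From HB Require Import structures.
From mathcomp Require Import all_boot all_order all_algebra all_fingroup.
From mathcomp Require Import all_classical all_reals all_analysis.
From mathcomp Require Import measurable_realfun ring lra.

Set Implicit Arguments.
Unset Strict Implicit.
Unset Printing Implicit Defensive.
Import Order.TTheory GRing.Theory Num.Theory.
Import numFieldNormedType.Exports.

Local Open Scope classical_set_scope.
Local Open Scope ring_scope.

(* For fixed z, the pairwise sampler is reversible with respect to the weights
   w_z(t) = \prod_j rhat(z_{t(n+j)}).  If the permutation of the data is drawn
   from these weights, then running the sampler to the hub and back makes the
   observed statistic and the H resampled ones exchangeable, so the p-value is
   valid.  This is the situation when Y_j has density proportional to rhat f: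
   the joint law of Z then has a density proportional to w_z(1) with respect to
   the (n + m)-fold product of f, which is exchangeable.  In general, let p and q
   be the densities of the samples tilted by rstar and rhat with respect to this
   product.  The conditional rejection probability phi takes values in [0, 1],
   so with D = {p > q} one has phi p + 1_D q <= phi q + 1_D p; integrating,
   P(reject) <= alpha + P_p(D) - P_q(D), and D depends on the last m coordinates
   only. *)

(** * Validity of rank p-values and products of transpositions *)

(** Among the indices counted on the left, take one, [l], minimising [v]. Every counted [l']
    satisfies [v l <= v l'], so all of them lie in the set attached to [l], which has at most [k]
    elements because [l] itself is counted. *)
Lemma card_small_rank (R : realType) (I : finType) (v : I -> R) (k : R) :
  0 <= k ->
  (#|[set l | #|[set l' | v l <= v l']|%:R <= k]%SET|%:R <= k).
Proof.
move=> k0; set L := [set l | _]%SET.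
have [->|[l0 l0L]] := set_0Vmem L; first by rewrite cards0.
case: (arg_minP v l0L) => l lL lmin.
have : l \in L by [].
rewrite {1}/L inE; apply: le_trans.
rewrite ler_nat; apply/subset_leq_card/fintype.subsetP => l' /lmin.
by move=> vl; rewrite inE.
Qed.

Section rank.
Context {R : realType} {T : finType}.
Variables (a v : T -> R).
Hypothesis a_ge0 : forall t, 0 <= a t.
Hypothesis a_sum : \sum_t a t = 1.

(** The coordinates [x i] are independent with common law [a], so exchanging [l0] with [l] shows
    that every index has a small rank with the same probability. Summing over all indices,
    [card_small_rank] bounds the number of small ranks by [alpha * #|I|] for each [x]. *)
Lemma exchangeable_rank_prob (I : finType) (l0 : I) (alpha : R) : 0 <= alpha ->
  \sum_(x : {ffun I -> T}) (\prod_i a (x i)) *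
    (#|[set l | v (x l0) <= v (x l)]%SET|%:R <= alpha * #|I|%:R)%R%:R <= alpha.
Proof.
move=> alpha0; pose G l (x : {ffun I -> T}) : bool :=
  #|[set l' | v (x l) <= v (x l')]%SET|%:R <= alpha * #|I|%:R.
pose E l := \sum_(x : {ffun I -> T}) (\prod_i a (x i)) * (G l x)%:R.
have EE l : E l = E l0.
  pose h (x : {ffun I -> T}) : {ffun I -> T} := [ffun i => x (tperm l0 l i)].
  have hK : involutive h by move=> x; apply/ffunP => i; rewrite !ffunE tpermK.
  rewrite /E (reindex_inj (inv_inj hK)); apply: eq_bigr => x _; congr (_ * _).
    rewrite (reindex_inj (@perm_inj _ (tperm l0 l))).
    by apply: eq_bigr => i _; rewrite ffunE tpermK.
  rewrite /G ffunE tpermR.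
  suff -> : [set l' | v (x l0) <= v (h x l')]%SET =
    tperm l0 l @: [set l' | v (x l0) <= v (x l')]%SET.
    by rewrite card_imset//; exact: perm_inj.
  apply/setP => i; rewrite inE ffunE; apply/idP/imsetP => [vi|[j + ->]].
    by exists (tperm l0 l i); rewrite ?tpermK// inE.
  by rewrite inE tpermK.
have I0 : 0 < #|I|%:R :> R by rewrite ltr0n; apply/card_gt0P; exists l0.
rewrite -/(E l0) -(ler_pM2r I0) mulr_natr -sumr_const.
under eq_bigr => l _ do rewrite -(EE l).
rewrite exchange_big /=.
(* The weights have total mass one, so the bound is itself an expectation and the two sides can be
   compared for each [x]. *)
have <- : \sum_(x : {ffun I -> T}) (\prod_i a (x i)) * (alpha * #|I|%:R) = alpha * #|I|%:R.
  rewrite -mulr_suml -(bigA_distr_bigA (fun=> a)) /=.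
  by rewrite big1 ?mul1r.
apply: ler_sum => x _; rewrite -mulr_sumr ler_wpM2l ?prodr_ge0//.
have := card_small_rank (v \o x) (mulr_ge0 alpha0 (ltW I0)).
apply: le_trans; rewrite -natr_sum ler_nat -sum1_card [leqRHS]big_mkcond /=.
by apply: leq_sum => l _; rewrite /G inE /=; case: ifP.
Qed.


(** Placing [t] at index [ord0] in front of [ss] gives [H.+1] independent draws from [a], and the
    p-value becomes the normalised rank of the draw at [ord0]. *)
Lemma rank_pvalue_prob H (alpha : R) : 0 <= alpha ->
  \sum_t \sum_(ss : {ffun 'I_H -> T}) a t * (\prod_h a (ss h)) *
    ((1 + H%:R)^-1 * (1 + \sum_(h < H) (v t <= v (ss h))%R%:R) <= alpha)%R%:R
  <= alpha.
Proof.
move=> alpha0.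
apply: le_trans (exchangeable_rank_prob (ord0 : 'I_H.+1) alpha0).
rewrite pair_big /= le_eqVlt; apply/orP; left; apply/eqP.
pose h (p : T * {ffun 'I_H -> T}) : {ffun 'I_H.+1 -> T} :=
  [ffun i => if unlift ord0 i is Some j then p.2 j else p.1].
pose h' (x : {ffun 'I_H.+1 -> T}) := (x ord0, [ffun j => x (lift ord0 j)]).
have hK : cancel h h'.
  move=> [t ss]; rewrite /h /h' ffunE unlift_none/=; congr pair.
  by apply/ffunP => j; rewrite !ffunE liftK.
have h'K : cancel h' h.
  move=> x; apply/ffunP => i; rewrite ffunE /=.
  by case: unliftP => [j ->|->//]; rewrite ffunE.
rewrite [RHS](reindex h)/=; last by exists h' => // x _.
apply: eq_bigr => -[t ss] _ /=.
have h0 : h (t, ss) ord0 = t by rewrite ffunE unlift_none.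
have hS j : h (t, ss) (lift ord0 j) = ss j by rewrite ffunE liftK.
rewrite big_ord_recl h0; congr (_ * _ * _).
  by apply: eq_bigr => j _; rewrite hS.
(* The leading [1] of the p-value is the comparison of the draw at [ord0] with itself. *)
congr (nat_of_bool _)%:R; rewrite ler_pdivrMl; last by rewrite addrC ltr_wpDl.
rewrite mulrC card_ord -natr1 [H%:R + 1]addrC; congr (_ <= _).
rewrite -sum1_card natr_sum [RHS]big_mkcond big_ord_recl inE h0 lexx /=; congr (_ + _).
by apply: eq_bigr => j _; rewrite inE hS; case: ifP.
Qed.

End rank.

Section disjoint_transpositions.
Context {N : nat} {I : finType}.
Variables (a c : I -> 'I_N) (b : pred I).
Hypotheses (a_inj : injective a) (c_inj : injective c).
Hypothesis ac : forall k l, a k != c l.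

Local Notation swaps s :=
  (\prod_(k <- s) (if b k then tperm (a k) (c k) else 1))%g.

Lemma swaps_fix s x : (forall k, a k != x) -> (forall k, c k != x) ->
  swaps s x = x.
Proof.
move=> ax cx; elim: s => [|k s ih]; first by rewrite big_nil perm1.
by rewrite big_cons permM; case: ifP => _; rewrite ?tpermD ?perm1.
Qed.

Let swaps_out s l : l \notin s ->
  swaps s (a l) = a l /\ swaps s (c l) = c l.
Proof.
elim: s => [|k s ih]; first by rewrite big_nil !perm1.
rewrite inE negb_or => /andP[lk /ih[ha hc]].
rewrite big_cons !permM; case: ifP => _; last by rewrite !perm1.
by rewrite !tpermD// 1?(eq_sym k) ?(inj_eq a_inj) ?(inj_eq c_inj) ?ac// 1?eq_sym ?ac//
  eq_sym.
Qed.

(** Each pair is touched by its own transposition only, and uniqueness of [s] prevents that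
    transposition from occurring twice and cancelling. *)
Lemma swapsE s l : uniq s ->
  swaps s (a l) = (if (l \in s) && b l then c l else a l) /\
  swaps s (c l) = (if (l \in s) && b l then a l else c l).
Proof.
elim: s => [|k s ih] /=; first by rewrite big_nil !perm1.
move=> /andP[ks /ih[ha hc]]; rewrite big_cons !permM inE.
have [->|lk] /= := eqVneq l k.
  have [ka kc] := swaps_out ks.
  by case: ifP => bk; rewrite ?tpermL ?tpermR ?perm1 ?ka ?kc.
rewrite -ha -hc; case: ifP => bk; rewrite ?perm1//.
by rewrite !tpermD// 1?(eq_sym k) ?(inj_eq a_inj) ?(inj_eq c_inj) ?ac// 1?eq_sym ?ac//
  eq_sym.
Qed.

End disjoint_transpositions.

(** * Reversibility of the pairwise sampler *)

Section sampler.
Context {X : Type} {R : realType} {n m : nat}.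
Variable r : X -> R.
Hypothesis r_gt0 : forall x, 0 < r x.
Implicit Types (z : (n + m).-tuple X) (s t u : 'S_(n + m)).

Local Notation K := (minn n m).

(** Stationary weight of the sampler: up to normalisation, the density at [permute z s] of the
    sample whose last [m] coordinates are tilted by [r], taken relative to the product law of
    [f]. *)
Definition sampler_weight z s : R :=
  \prod_(j < m) r (tnth z (s (rshift n j))).

Lemma sampler_weight_ge0 z s : 0 <= sampler_weight z s.
Proof. by apply: prodr_ge0 => j _; exact: ltW. Qed.

Lemma swap_prob_ge0 z s a c : 0 <= swap_prob r z s a c.
Proof. by rewrite divr_ge0// ?addr_ge0// ltW. Qed.

Lemma onem_swap_prob_ge0 z s a c : 0 <= 1 - swap_prob r z s a c.
Proof. by rewrite subr_ge0 ler_pdivrMr ?addr_gt0// mul1r lerDl ltW. Qed.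

Lemma swaps_prob_ge0 z i j b s : 0 <= swaps_prob r z i j b s.
Proof.
apply: prodr_ge0 => k _ /=.
by case: ifP => _; [exact: swap_prob_ge0|exact: onem_swap_prob_ge0].
Qed.

Lemma sum_swaps_prob z i j s :
  \sum_(b : {ffun 'I_K -> bool}) swaps_prob r z i j b s = 1.
Proof.
rewrite /swaps_prob -(bigA_distr_bigA (fun k (b : bool) =>
  if b then swap_prob r z s (lshift m (i k)) (rshift n (j k))
  else 1 - swap_prob r z s (lshift m (i k)) (rshift n (j k)))) /=.
by rewrite big1// => k _; rewrite big_bool /= subrKC.
Qed.

(** The first [K] indices in order form a valid draw. This keeps the uniform normalisation in
    [pairwise_step] from dividing by zero. *)
Lemma card_draws_gt0 N : (K <= N)%N -> (0 < #|draws (n := n) (m := m) N|)%N.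
Proof.
move=> KN; apply/card_gt0P; exists [ffun k => widen_ord KN k].
rewrite inE; apply/injectiveP => k l; rewrite !ffunE => /(congr1 val) /= kl.
exact/val_inj.
Qed.

Lemma pairwise_step_ge0 z s t : 0 <= pairwise_step r z s t.
Proof.
rewrite /pairwise_step !mulr_ge0 ?invr_ge0//.
do 3 (apply: sumr_ge0 => ? _); by rewrite mulr_ge0 ?swaps_prob_ge0.
Qed.

Lemma sum_pairwise_step z s : \sum_t pairwise_step r z s t = 1.
Proof.
rewrite /pairwise_step -mulr_sumr exchange_big /=.
under eq_bigr => i _.
  rewrite exchange_big /=; under eq_bigr => j _.
    rewrite exchange_big /=; under eq_bigr => b _.
      rewrite -mulr_sumr (bigD1 (swap_pairs i j b s))//= eqxx big1 ?addr0 ?mulr1; last first.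
        by move=> t /negPf; rewrite eq_sym => ->.
      over.
    rewrite sum_swaps_prob; over.
  rewrite sumr_const; over.
rewrite sumr_const -[X in _ * X]mulr_natr.
have n0 : #|draws (n := n) (m := m) n|%:R != 0 :> R.
  by rewrite pnatr_eq0 -lt0n card_draws_gt0// geq_minl.
have m0 : #|draws (n := n) (m := m) m|%:R != 0 :> R.
  by rewrite pnatr_eq0 -lt0n card_draws_gt0// geq_minr.
by field; rewrite n0 m0.
Qed.

Section swap.
Variables (i : {ffun 'I_K -> 'I_n}) (j : {ffun 'I_K -> 'I_m}).
Variable b : {ffun 'I_K -> bool}.
Hypotheses (i_inj : injective i) (j_inj : injective j).

Let a_inj : injective (fun k => lshift m (i k)).
Proof. by move=> k l /lshift_inj/i_inj. Qed.

Let c_inj : injective (fun k => rshift n (j k)).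
Proof. by move=> k l /rshift_inj/j_inj. Qed.

Let ac k l : lshift m (i k) != rshift n (j l).
Proof. by rewrite eq_lrshift. Qed.

Lemma swap_pairs_lshift s k : swap_pairs i j b s (lshift m (i k)) =
  s (if b k then rshift n (j k) else lshift m (i k)).
Proof.
have [E _] := swapsE b a_inj c_inj ac k (index_enum_uniq 'I_K).
by rewrite /swap_pairs permM E mem_index_enum.
Qed.

Lemma swap_pairs_rshift s k : swap_pairs i j b s (rshift n (j k)) =
  s (if b k then lshift m (i k) else rshift n (j k)).
Proof.
have [_ E] := swapsE b a_inj c_inj ac k (index_enum_uniq 'I_K).
by rewrite /swap_pairs permM E mem_index_enum.
Qed.

Lemma swap_pairs_fix s x :
  (forall k, lshift m (i k) != x) -> (forall k, rshift n (j k) != x) ->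
  swap_pairs i j b s x = s x.
Proof. by move=> ax cx; rewrite /swap_pairs permM swaps_fix. Qed.

(** The transpositions have disjoint supports, so repeating the same swaps undoes them; the reverse
    of a move thus uses the same [i], [j] and [b]. *)
Lemma swap_pairsK : involutive (swap_pairs i j b).
Proof.
move=> s; apply/permP => x.
have [/existsP[k /eqP <-]|/existsPn ax] := boolP [exists k, lshift m (i k) == x].
  rewrite swap_pairs_lshift; case: ifP => bk.
    by rewrite swap_pairs_rshift bk.
  by rewrite swap_pairs_lshift bk.
have [/existsP[k /eqP <-]|/existsPn cx] := boolP [exists k, rshift n (j k) == x].
  rewrite swap_pairs_rshift; case: ifP => bk.
    by rewrite swap_pairs_lshift bk.
  by rewrite swap_pairs_rshift bk.
by rewrite !swap_pairs_fix.
Qed.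

Lemma swap_pairs_balance z s :
  sampler_weight z s * swaps_prob r z i j b s =
  sampler_weight z (swap_pairs i j b s) *
    swaps_prob r z i j b (swap_pairs i j b s).
Proof.
set t := swap_pairs i j b s.
(* The positions of the second sample are split into the drawn ones, matched with the factors of
   [swaps_prob], and the others, which the swaps leave alone. *)
have wE u : sampler_weight z u =
    (\prod_(k < K) r (tnth z (u (rshift n (j k))))) *
    \prod_(l | l \notin codom j) r (tnth z (u (rshift n l))).
  rewrite /sampler_weight (bigID (mem (codom j))) /=; congr (_ * _).
  rewrite (eq_bigl (mem (j @: 'I_K))); last first.
    by move=> l /=; apply/codomP/imsetP => -[k]; [exists k|move=> _ ?; exists k].
  by rewrite big_imset//= => k l _ _ /j_inj.
rewrite !wE mulrAC [RHS]mulrAC; congr (_ * _); last first.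
  apply: eq_bigr => l lj; rewrite /t swap_pairs_fix// => k.
    by rewrite eq_lrshift.
  rewrite eq_rshift; apply: contraNneq lj => <-; exact: codom_f.
rewrite /swaps_prob -!big_split /=; apply: eq_bigr => k _.
rewrite /swap_prob /t swap_pairs_lshift swap_pairs_rshift.
(* An unswapped pair contributes the same factor on both sides. A swapped pair with values [x] and
   [y] of [r] contributes [x * y / (x + y)], which is symmetric. *)
case: ifP => bk //=.
have := r_gt0 (tnth z (s (lshift m (i k)))).
have := r_gt0 (tnth z (s (rshift n (j k)))).
move: (r _) (r _) => x y x0 y0.
by field; rewrite !gt_eqF ?addr_gt0.
Qed.

End swap.

(** Detailed balance holds term by term: for fixed [i], [j] and [b], the swaps lead from [s] to [t]
    exactly when they lead from [t] to [s]. *)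
Lemma pairwise_step_reversible z s t :
  sampler_weight z s * pairwise_step r z s t =
  sampler_weight z t * pairwise_step r z t s.
Proof.
rewrite /pairwise_step mulrCA [RHS]mulrCA; congr (_ * _).
rewrite !mulr_sumr; apply: eq_bigr => i /[!inE] /injectiveP i_inj.
rewrite !mulr_sumr; apply: eq_bigr => j /[!inE] /injectiveP j_inj.
rewrite !mulr_sumr; apply: eq_bigr => b _.
rewrite !mulrA.
have [<-|st] := eqVneq (swap_pairs i j b s) t.
  by rewrite swap_pairsK// eqxx swap_pairs_balance.
rewrite !mulr0; have [ts|_] := eqVneq; last by rewrite mulr0.
by rewrite -ts swap_pairsK ?eqxx in st.
Qed.

Lemma pairwise_sampler_ge0 z S s t : 0 <= pairwise_sampler r z S s t.
Proof.
elim: S t => [|S ih] t /=; first exact: ler0n.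
by apply: sumr_ge0 => u _; rewrite mulr_ge0 ?pairwise_step_ge0.
Qed.

Lemma sum_pairwise_sampler z S s : \sum_t pairwise_sampler r z S s t = 1.
Proof.
elim: S => [|S ih] /=.
  by rewrite (bigD1 s)//= eqxx big1 ?addr0// => t /negPf; rewrite eq_sym => ->.
rewrite exchange_big /=.
by under eq_bigr => u _ do rewrite -mulr_sumr sum_pairwise_step mulr1.
Qed.

(** The recursion defining the sampler splits off the last step. Reversing a trajectory exchanges
    its first and last steps, so the other decomposition is needed too. *)
Lemma pairwise_samplerSl z S s t : pairwise_sampler r z S.+1 s t =
  \sum_u pairwise_step r z s u * pairwise_sampler r z S u t.
Proof.
elim: S t => [|S ih] t.
  rewrite /= (bigD1 s)//= eqxx mul1r big1 ?addr0; last first.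
    by move=> u /negPf; rewrite eq_sym => ->; rewrite mul0r.
  rewrite (bigD1 t)//= eqxx mulr1 big1 ?addr0//.
  by move=> u /negPf ->; rewrite mulr0.
transitivity (\sum_u pairwise_sampler r z S.+1 s u * pairwise_step r z u t) => //.
under eq_bigr => u _ do rewrite ih mulr_suml.
rewrite exchange_big /=; apply: eq_bigr => v _; rewrite mulr_sumr.
by apply: eq_bigr => u _; rewrite mulrA.
Qed.

Lemma pairwise_sampler_reversible z S s t :
  sampler_weight z s * pairwise_sampler r z S s t =
  sampler_weight z t * pairwise_sampler r z S t s.
Proof.
elim: S s t => [|S ih] s t.
  by rewrite /= [t == s]eq_sym; case: eqVneq => [->|_]; rewrite ?mulr0.
rewrite pairwise_samplerSl /= !mulr_sumr; apply: eq_bigr => u _.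
by rewrite mulrA pairwise_step_reversible -mulrA [_ u s * _]mulrC !mulrA ih.
Qed.

Lemma tnth_permute z t k : tnth (permute z t) k = tnth z (t k).
Proof. by rewrite tnth_mktuple. Qed.

Lemma permuteM z s t : permute (permute z t) s = permute z (s * t)%g.
Proof. by apply: eq_from_tnth => k; rewrite !tnth_permute permM. Qed.

(** The step sees the data only through the values [z] at [s], so permuting the data by [t] amounts
    to multiplying all states by [t] on the right. *)
Lemma pairwise_step_permute z t s u :
  pairwise_step r (permute z t) s u = pairwise_step r z (s * t)%g (u * t)%g.
Proof.
rewrite /pairwise_step; congr (_ * _).
apply: eq_bigr => i _; apply: eq_bigr => j _; apply: eq_bigr => b _.
congr (_ * _).
  by apply: eq_bigr => k _; rewrite /swap_prob !tnth_permute !permM.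
by rewrite /swap_pairs mulgA (inj_eq (mulIg t)).
Qed.

Lemma pairwise_sampler_permute z t S s u :
  pairwise_sampler r (permute z t) S s u =
  pairwise_sampler r z S (s * t)%g (u * t)%g.
Proof.
elim: S u => [|S ih] u /=; first by rewrite (inj_eq (mulIg t)).
rewrite [RHS](reindex_inj (mulIg t)) /=.
by apply: eq_bigr => v _; rewrite ih pairwise_step_permute.
Qed.

(** * Conditional rejection probability and its weighted average over permutations *)

Section rejection.
Context {H : nat}.
Variables (S : nat) (T : (n + m).-tuple X -> R) (alpha : R).
Hypothesis alpha0 : 0 <= alpha.

(* The conditional probability given [Z = z] that the test rejects. *)
Definition rejection_prob z : R :=
  \sum_s \sum_(ss : {ffun 'I_H -> 'S_(n + m)})
    drpt_pmf r z S 1%g s ss * (drpt_pvalue T z ss <= alpha)%R%:R.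

Lemma drpt_pmf_ge0 z s (ss : 'I_H -> 'S_(n + m)) : 0 <= drpt_pmf r z S 1%g s ss.
Proof.
by rewrite mulr_ge0 ?prodr_ge0 ?pairwise_sampler_ge0// => h _; exact: pairwise_sampler_ge0.
Qed.

Lemma rejection_prob_ge0 z : 0 <= rejection_prob z.
Proof. by do 2 (apply: sumr_ge0 => ? _); rewrite mulr_ge0 ?drpt_pmf_ge0. Qed.

Lemma rejection_prob_le1 z : rejection_prob z <= 1.
Proof.
rewrite -[leRHS](sum_pairwise_sampler z S 1%g); apply: ler_sum => s _.
have ss1 : \sum_(ss : {ffun 'I_H -> 'S_(n + m)})
    \prod_h pairwise_sampler r z S s (ss h) = 1.
  rewrite -(bigA_distr_bigA (fun=> pairwise_sampler r z S s)) /=.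
  by rewrite big1// => h _; exact: sum_pairwise_sampler.
rewrite -[leRHS]mulr1 -[X in _ <= _ * X]ss1 mulr_sumr; apply: ler_sum => ss _.
by rewrite ler_piMr ?drpt_pmf_ge0//; rewrite lern1 leq_b1.
Qed.

(** Testing the permuted data from the identity is the same as testing [z] from [t]: hub and
    resampled permutations are relabelled by right multiplication by [t]. *)
Lemma rejection_prob_permute z t : rejection_prob (permute z t) =
  \sum_s \sum_(ss : {ffun 'I_H -> 'S_(n + m)})
    drpt_pmf r z S t s ss *
    ((1 + H%:R)^-1 * (1 + \sum_(h < H)
      (T (permute z t) <= T (permute z (ss h)))%R%:R) <= alpha)%R%:R.
Proof.
rewrite [RHS](reindex_inj (mulIg t)) /=; apply: eq_bigr => s _.
pose f (ss : {ffun 'I_H -> 'S_(n + m)}) : {ffun 'I_H -> 'S_(n + m)} :=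
  [ffun h => ss h * t]%g.
have f_inj : injective f.
  by move=> x y /ffunP xy; apply/ffunP => h; have := xy h; rewrite !ffunE => /mulIg.
rewrite [RHS](reindex_inj f_inj) /=; apply: eq_bigr => ss _; congr (_ * _).
  rewrite /drpt_pmf pairwise_sampler_permute mul1g; congr (_ * _).
  by apply: eq_bigr => h _; rewrite pairwise_sampler_permute ffunE.
rewrite /drpt_pvalue; congr ((_ * (_ + _) <= _)%R%:R).
by apply: eq_bigr => h _; rewrite permuteM ffunE.
Qed.

(* By reversibility, drawing [t] from the weights and then running the sampler
   to the hub [s] amounts to drawing [s] from the weights and running it back,
   so [t] and the [ss h] are exchangeable given [s]. *)
Lemma sum_weight_rejection_prob z :
  \sum_t sampler_weight z t * rejection_prob (permute z t) <=
  alpha * \sum_t sampler_weight z t.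
Proof.
under eq_bigr do rewrite rejection_prob_permute mulr_sumr.
rewrite exchange_big /= mulr_sumr; apply: ler_sum => s _.
rewrite mulrC.
have := rank_pvalue_prob (fun t => T (permute z t))
  (pairwise_sampler_ge0 z S s) (sum_pairwise_sampler z S s) H alpha0.
move=> /(ler_wpM2l (sampler_weight_ge0 z s)); apply: le_trans.
rewrite le_eqVlt; apply/orP; left; apply/eqP.
rewrite mulr_sumr; apply: eq_bigr => t _.
rewrite !mulr_sumr; apply: eq_bigr => ss _.
by rewrite /drpt_pmf !mulrA pairwise_sampler_reversible.
Qed.

End rejection.

End sampler.

(** * Densities and product laws *)

Section integral_density_law.
Context {d : measure_display} {X : measurableType d} {R : realType}
  {mu : {measure set X -> \bar R}}.
Variable q : density mu.
Local Open Scope ereal_scope.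
Import HBNNSimple.

Let mq : measurable_fun [set: X] (fun x => (q x)%:E).
Proof. by apply/measurable_EFinP; exact: measurable_pdf. Qed.

(** Both integrals are limits along the same increasing simple functions, by monotone convergence.
    This reduces the identity to indicators of level sets, where it is the definition of
    [density_law]. *)
Lemma integral_density_law (h : X -> \bar R) : measurable_fun setT h ->
  (forall x, 0 <= h x) ->
  \int[density_law q]_x h x = \int[mu]_x (h x * (q x)%:E).
Proof.
move=> mh h0; pose s := nnsfun_approx measurableT mh.
have sh x : (s n x)%:E @[n --> \oo] --> h x by exact: cvg_nnsfun_approx.
have nds x : {homo (fun n => (s n x)%:E) : a b / (a <= b)%N >-> a <= b}.
  by move=> a b ab; rewrite lee_fin; exact/lefP/nd_nnsfun_approx.
have -> : \int[density_law q]_x h x =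
    lim (\int[density_law q]_x (s n x)%:E @[n --> \oo]).
  rewrite -monotone_convergence//.
  - by apply: eq_integral => x _; apply/esym/cvg_lim.
  - by move=> n; apply/measurable_EFinP; exact: measurable_funP.
  - by move=> n x _; rewrite lee_fin.
have -> : \int[mu]_x (h x * (q x)%:E) =
    lim (\int[mu]_x ((s n x)%:E * (q x)%:E) @[n --> \oo]).
  rewrite -monotone_convergence//.
  - apply: eq_integral => x _; apply/esym/cvg_lim => //.
    by apply: cvgeZr => //; exact: sh.
  - move=> n; apply: emeasurable_funM => //.
    by apply/measurable_EFinP; exact: measurable_funP.
  - by move=> n x _; rewrite mule_ge0// lee_fin// pdf_ge0.
  - move=> x _ a b ab; rewrite lee_wpmul2r ?lee_fin ?pdf_ge0//.
    by rewrite -lee_fin nds.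
apply: congr_lim; apply/funext => n.
have mind y : measurable_fun setT (fun x => (y * \1_(s n @^-1` [set y]) x)%:E).
  by apply/measurable_EFinP; exact: measurable_funM.
transitivity (\int[density_law q]_x
    (\sum_(y \in range (s n)) (y * \1_(s n @^-1` [set y]) x)%:E)).
  by apply: eq_integral => x _; rewrite fsumEFin// -fimfunE.
rewrite ge0_integral_fsum//; last by move=> y x _; exact: nnfun_muleindic_ge0.
transitivity (\int[mu]_x (\sum_(y \in range (s n))
    (y * \1_(s n @^-1` [set y]) x)%:E * (q x)%:E)); last first.
  apply: eq_integral => x _.
  rewrite -ge0_mule_fsuml => [|y]; last exact: nnfun_muleindic_ge0.
  by rewrite fsumEFin // -(fimfunE _ x).
rewrite ge0_integral_fsum//; last 2 first.
- by move=> y; apply: emeasurable_funM.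
- by move=> y x _; rewrite mule_ge0 ?lee_fin ?pdf_ge0//; exact: nnfun_muleindic_ge0.
apply: eq_fsbigr => y; rewrite inE => -[x _ <-{y}]; set y := s n x.
have y0 : (0 <= y)%R by exact: fun_ge0.
under eq_integral do rewrite EFinM.
rewrite ge0_integralZl ?lee_fin//; last by apply/measurable_EFinP.
rewrite integral_indic// setIT.
under [RHS]eq_integral do rewrite EFinM -muleA.
rewrite ge0_integralZl ?lee_fin//; last 2 first.
- by apply: emeasurable_funM => //; exact/measurable_EFinP.
- by move=> t _; rewrite mule_ge0// lee_fin// pdf_ge0.
congr (_ * _); rewrite /= /density_law integral_mkcond/=.
apply: eq_integral => t _; rewrite patchE indicE.
by case: ifP => _; rewrite ?mul1e ?mul0e.
Qed.

End integral_density_law.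

(** * Rectangles as a generating class, and integrals against product laws *)

Section rectangles.
Context {d : measure_display} {X : measurableType d} {R : realType}.

Definition rectangle N (A : 'I_N -> set X) : set (N.-tuple X) :=
  [set z | forall i, A i (tnth z i)].

Lemma indic_rectangle N (A : 'I_N -> set X) z :
  \1_(rectangle A) z = \prod_i \1_(A i) (tnth z i) :> R.
Proof.
rewrite indicE; case: (boolP (z \in _)) => [/set_mem zA|/negP zA].
  by rewrite big1// => i _; rewrite indicE mem_set//; exact: zA.
have [i Ai] : exists i, ~ A i (tnth z i).
  by apply/existsNP => Az; apply: zA; rewrite inE.
by rewrite (bigD1 i)//= indicE memNset// mul0r.
Qed.

Lemma measurable_rectangle N (A : 'I_N -> set X) :
  (forall i, measurable (A i)) -> measurable (rectangle A).
Proof.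
move=> mA.
rewrite (_ : rectangle A = \bigcap_(i in [set: 'I_N]) ((@tnth N X ^~ i) @^-1` A i)).
  apply: fin_bigcap_measurable => // i _; rewrite -[X in measurable X]setTI.
  exact: measurable_tnth.
by apply/seteqP; split => z; [move=> zA i _; exact: zA|move=> zA i; exact: zA].
Qed.

(** Rectangles are stable under intersection, contain the whole space and generate the product
    sigma-algebra, so they determine a probability. *)
Lemma rectangle_eq_measure N (P1 P2 : probability (N.-tuple X) R) :
  (forall A : 'I_N -> set X, (forall i, measurable (A i)) ->
    P1 (rectangle A) = P2 (rectangle A)) ->
  forall B, measurable B -> P1 B = P2 B.
Proof.
move=> P12; pose G := [set B : set (N.-tuple X) |
  exists2 A : 'I_N -> set X, (forall i, measurable (A i)) & B = rectangle A].
have GT : G setT.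
  by exists (fun=> setT) => //; apply/seteqP; split.
move=> B mB; apply: (@g_sigma_algebra_measure_unique _ _ _ G _ (fun=> setT)) => //.
- by move=> _ [A mA ->]; exact: measurable_rectangle.
- by rewrite bigcup_const//; exists 0%N.
- move=> _ _ [A1 mA1 ->] [A2 mA2 ->]; exists (fun i => A1 i `&` A2 i).
    by move=> i; exact: measurableI.
  apply/seteqP; split => z; first by move=> [z1 z2] i; split; [exact: z1|exact: z2].
  by move=> z12; split => i; have [] := z12 i.
- by move=> _ [A mA ->]; exact: P12.
- by move=> _; apply: (le_lt_trans (probability_le1 P1 _)); rewrite ?ltry.
- apply: (smallest_sub _ _ mB); first exact: smallest_sigma_algebra.
  move=> C; rewrite -bigcup_seq => -[i /= _ [D mD <-]].
  (* A generating cylinder is the rectangle all of whose other sides are the whole space. *)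
  apply: sub_sigma_algebra; exists (fun j => if j == i then D else setT).
    by move=> j; case: ifP.
  rewrite setTI; apply/seteqP; split => z /=.
    by move=> Dz j; case: eqP => // ->.
  by move=> /(_ i); rewrite eqxx.
Qed.

End rectangles.

Section product_integral.
Context {d : measure_display} {X : measurableType d} {R : realType}.
Variable F : probability X R.
Local Open Scope ereal_scope.

Lemma measurable_prod_tnth N (h : 'I_N -> X -> R) :
  (forall i, measurable_fun setT (h i)) ->
  measurable_fun setT (fun z : N.-tuple X => (\prod_i h i (tnth z i))%R).
Proof.
move=> mh; apply: measurable_prod => i _.
by apply: (measurableT_comp (mh i)); exact: measurable_tnth.
Qed.

(** By induction on [N], Tonelli's theorem separates the first coordinate from the remaining
    ones. *)
Lemma integral_product_law N (h : 'I_N -> X -> R) :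
  (forall i, measurable_fun setT (h i)) -> (forall i x, 0 <= h i x)%R ->
  \int[product_law F N]_z (\prod_i h i (tnth z i))%R%:E =
  \prod_i \int[F]_x (h i x)%:E.
Proof.
elim: N h => [|N ih] h mh h0.
  rewrite big_ord0 /= integral_dirac//; first by rewrite diracT big_ord0 mul1e.
  by apply/measurable_EFinP; exact: measurable_prod_tnth.
have h0' x : (0 <= \prod_i h i (tnth x i))%R by exact: prodr_ge0.
rewrite /= ge0_integral_distribution//; last first.
  by apply/measurable_EFinP; exact: measurable_prod_tnth.
rewrite fubini_tonelli1//; last 2 first.
- apply: measurableT_comp; last exact: measurable_cons_pair.
  by apply/measurable_EFinP; exact: measurable_prod_tnth.
- by move=> p /=; rewrite lee_fin.
rewrite /fubini_F big_ord_recl.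
pose G (t : N.-tuple X) : R := (\prod_(i < N) h (lift ord0 i) (tnth t i))%R.
have G0 t : (0 <= G t)%R by exact: prodr_ge0.
have mG : measurable_fun setT (EFin \o G).
  by apply/measurable_EFinP; exact: (@measurable_prod_tnth N (fun i => h (lift ord0 i))).
transitivity (\int[F]_x ((h ord0 x)%:E * \int[product_law F N]_t (G t)%:E)).
  apply: eq_integral => x _.
  rewrite -ge0_integralZl// ?lee_fin//; last by move=> t _; rewrite lee_fin.
  apply: eq_integral => t _ /=.
  rewrite big_ord_recl -EFinM; congr (_ * _)%R%:E.
  by apply: eq_bigr => i _; rewrite tnthS.
rewrite ge0_integralZr//; last 3 first.
- exact/measurable_EFinP.
- by move=> x _; rewrite lee_fin.
- by apply: integral_ge0 => t _; rewrite lee_fin.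
by rewrite (ih (fun i => h (lift ord0 i))).
Qed.

Lemma product_law_rectangle N (A : 'I_N -> set X) :
  (forall i, measurable (A i)) ->
  product_law F N (rectangle A) = \prod_i F (A i).
Proof.
move=> mA; rewrite -[rectangle A]setIT -integral_indic//; last exact: measurable_rectangle.
under eq_integral do rewrite indic_rectangle.
rewrite (integral_product_law (h := fun i => \1_(A i)))//.
by apply: eq_bigr => i _; rewrite integral_indic// setIT.
Qed.

Lemma measurable_permute N (t : 'S_N) :
  measurable_fun setT (fun z : N.-tuple X => permute z t).
Proof.
apply/measurable_fun_tnthP => i.
rewrite (_ : _ \o _ = @tnth N X ^~ (t i)); first exact: measurable_tnth.
by apply/funext => z /=; rewrite tnth_mktuple.
Qed.

Lemma integral_product_law_permute N (t : 'S_N) (h : N.-tuple X -> \bar R) :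
  measurable_fun setT h -> (forall z, 0 <= h z) ->
  \int[product_law F N]_z h (permute z t) = \int[product_law F N]_z h z.
Proof.
move=> mh h0.
pose Mt := isMeasurableFun.Build _ _ _ _ _ (measurable_permute t).
pose pt : {RV (product_law F N) >-> N.-tuple X} := HB.pack (fun z : N.-tuple X => permute z t) Mt.
transitivity (\int[distribution (product_law F N) pt]_z h z).
  by rewrite ge0_integral_distribution.
apply: eq_measure_integral => B mB _.
apply: (rectangle_eq_measure (P1 := distribution _ pt)) => // A mA.
(* The preimage of a rectangle under [permute _ t] is the rectangle whose sides are rearranged by
   the inverse of [t], so the product of side probabilities is unchanged. *)
rewrite product_law_rectangle// (reindex_inj (@perm_inj _ t^-1%g)).
rewrite -(product_law_rectangle (A := fun i => A (t^-1%g i)))//.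
rewrite /distribution /pushforward; congr (product_law F N _).
apply/seteqP; split => z /= zA i; last by have := zA (t i); rewrite tnth_mktuple permK.
by have := zA (t^-1%g i); rewrite tnth_mktuple permKV.
Qed.

Section product_density.
Context {N : nat}.
Variable k : 'I_N -> density F.

Definition product_pdf (z : N.-tuple X) : R := (\prod_i k i (tnth z i))%R.

Lemma measurable_product_pdf : measurable_fun setT product_pdf.
Proof. by apply: (@measurable_prod_tnth N k) => i; exact: measurable_pdf. Qed.

Lemma product_pdf_ge0 z : (0 <= product_pdf z)%R.
Proof. by apply: prodr_ge0 => i _; exact: pdf_ge0. Qed.

Lemma integral_product_pdf : \int[product_law F N]_z (product_pdf z)%:E = 1.
Proof.
rewrite (integral_product_law (h := k)); last 2 first.
- by move=> i; exact: measurable_pdf.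
- by move=> i x; exact: pdf_ge0.
by rewrite big1// => i _; exact: integral_pdf.
Qed.

Definition product_density : density (product_law F N) :=
  Density measurable_product_pdf product_pdf_ge0 integral_product_pdf.

Lemma product_density_rectangle (A : 'I_N -> set X) :
  (forall i, measurable (A i)) ->
  density_law product_density (rectangle A) = \prod_i density_law (k i) (A i).
Proof.
move=> mA; rewrite /= /density_law integral_mkcond/=.
transitivity (\int[product_law F N]_z
    (\prod_i (k i (tnth z i) * \1_(A i) (tnth z i)))%R%:E).
  apply: eq_integral => z _; rewrite restrict_EFin/= patch_indic/=.
  by rewrite indic_rectangle -big_split.
rewrite (integral_product_law (h := fun i x => (k i x * \1_(A i) x)%R)).
- apply: eq_bigr => i _; rewrite [RHS]integral_mkcond.
  by apply: eq_integral => x _; rewrite restrict_EFin/= patch_indic.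
- by move=> i; apply: measurable_funM => //; exact: measurable_pdf.
- by move=> i x; rewrite mulr_ge0// pdf_ge0.
Qed.

End product_density.
End product_integral.

Section relative_tilt.
Context {d : measure_display} {X : measurableType d} {R : realType}
  {mu : {measure set X -> \bar R}}.
Variables (f : density mu) (r : posfun X R).
Hypothesis fin : (tilt_mass f r < +oo)%E.

(** The tilted density taken relative to the law of [f] instead of [mu]. All samples then have
    densities with respect to one exchangeable probability, the product law of [f]. *)
Definition relative_tilt_pdf (x : X) : R := (fine (tilt_mass f r))^-1 * r x.

Lemma measurable_relative_tilt_pdf : measurable_fun [set: X] relative_tilt_pdf.
Proof. by apply: measurable_funM => //; exact: measurable_pos_fun. Qed.

Lemma relative_tilt_pdf_ge0 x : 0 <= relative_tilt_pdf x.
Proof.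
rewrite mulr_ge0 ?invr_ge0 ?fine_ge0//; first exact/ltW/tilt_mass_gt0.
exact/ltW/pos_fun_gt0.
Qed.

Lemma integral_relative_tilt_pdf :
  (\int[density_law f]_x (relative_tilt_pdf x)%:E = 1)%E.
Proof.
rewrite integral_density_law -?(integral_tilt_pdf fin)//.
- by apply/measurable_EFinP; exact: measurable_relative_tilt_pdf.
- by move=> x; rewrite lee_fin relative_tilt_pdf_ge0.
Qed.

Definition relative_tilt : density (density_law f) :=
  Density measurable_relative_tilt_pdf relative_tilt_pdf_ge0
    integral_relative_tilt_pdf.

Lemma relative_tilt_law A : measurable A ->
  density_law relative_tilt A = density_law (tilt f r fin) A.
Proof.
move=> mA; rewrite /= /density_law integral_mkcond [RHS]integral_mkcond.
rewrite restrict_EFin integral_density_law.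
- apply: eq_integral => x _; rewrite restrict_EFin/= !patch_indic/= -EFinM.
  by rewrite mulrAC.
- apply/measurable_EFinP/(measurable_restrictT _ _).1 => //.
  by apply: measurable_funTS; exact: measurable_relative_tilt_pdf.
- by move=> x; rewrite lee_fin patch_indic/= mulr_ge0// relative_tilt_pdf_ge0.
Qed.

End relative_tilt.

Section sample_density.
Context {d : measure_display} {X : measurableType d} {R : realType}.
Variable F : probability X R.

Lemma integral_cst1 : (\int[F]_x (cst 1 x : R)%:E = 1)%E.
Proof.
rewrite -[LHS]/(\int[F]_x cst 1 x)%E (integral_cst F measurableT) mul1e.
exact: probability_setT.
Qed.

Definition unit_density : density F :=
  Density (measurable_cst (1 : R)) (fun=> ler01) integral_cst1.

Lemma unit_density_law A : measurable A -> density_law unit_density A = F A.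
Proof. by move=> mA; rewrite -[LHS]/(\int[F]_(x in A) cst 1 x)%E (integral_cst F mA) mul1e. Qed.

Variables (n m : nat) (k : density F).

(** The first [n] coordinates follow the reference law [F] and so have density one; the joint
    density depends on the last [m] coordinates only. *)
Definition sample_density : density (product_law F (n + m)) :=
  product_density (fun i => if fintype.split i is inl _ then unit_density else k).

Lemma sample_densityE z :
  sample_density z = \prod_(j < m) k (tnth z (rshift n j)).
Proof.
rewrite /= /product_pdf big_split_ord /= big1 ?mul1r => [|i _].
  by apply: eq_bigr => j _; rewrite (unsplitK (inr j)).
by rewrite (unsplitK (inl i)).
Qed.

Lemma sample_density_rectangle (A : 'I_(n + m) -> set X) :
  (forall i, measurable (A i)) ->
  (density_law sample_density (rectangle A) =
   \prod_(i < n) F (A (lshift m i)) *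
   \prod_(j < m) density_law k (A (rshift n j)))%E.
Proof.
move=> mA; rewrite product_density_rectangle// big_split_ord; congr (_ * _)%E.
- by apply: eq_bigr => i _; rewrite (unsplitK (inl i)) unit_density_law.
- by apply: eq_bigr => j _; rewrite (unsplitK (inr j)).
Qed.

Definition last_coords (z : (n + m).-tuple X) : m.-tuple X :=
  [tuple tnth z (rshift n j) | j < m].

Lemma measurable_last_coords : measurable_fun setT last_coords.
Proof.
apply/measurable_fun_tnthP => i.
rewrite (_ : _ \o _ = @tnth _ X ^~ (rshift n i)); first exact: measurable_tnth.
by apply/funext => z /=; rewrite tnth_mktuple.
Qed.

Lemma sample_density_marginal (G : probability X R) (B : set (m.-tuple X)) :
  (forall A, measurable A -> density_law k A = G A) -> measurable B ->
  density_law sample_density (last_coords @^-1` B) = product_law G m B.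
Proof.
move=> kG mB.
pose Ml := isMeasurableFun.Build _ _ _ _ _ measurable_last_coords.
pose l : {RV (density_law sample_density) >-> m.-tuple X} :=
  HB.pack last_coords Ml.
apply: (rectangle_eq_measure (P1 := distribution _ l)) => // A mA.
rewrite product_law_rectangle//.
(* The rectangle on the last [m] coordinates pulls back to one whose first [n] sides are the whole
   space. *)
pose A' (i : 'I_(n + m)) := if fintype.split i is inr j then A j else setT.
transitivity (density_law sample_density (rectangle A')).
  rewrite /distribution /pushforward; congr (density_law sample_density _).
  apply/seteqP; split => z /= zA i.
    rewrite /A'; case: split_ordP => j ij//.
    by have := zA j; rewrite tnth_mktuple ij.
  by have := zA (rshift n i); rewrite /A' (unsplitK (inr i)) tnth_mktuple.
rewrite sample_density_rectangle; last first.
  by move=> i; rewrite /A'; case: fintype.split.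
rewrite big1 ?mul1e => [|i _]; last by rewrite /A' (unsplitK (inl i)) probability_setT.
by apply: eq_bigr => j _; rewrite /A' (unsplitK (inr j)) kG.
Qed.

End sample_density.

(** Independence over the full set of coordinates gives the product formula on rectangles, which
    determine the law of [Z]. *)
Lemma two_sample_law (d dO : measure_display) (X : measurableType d)
    (Omega : measurableType dO) (R : realType) (mu : {measure set X -> \bar R})
    (f g : density mu) (P : probability Omega R) (n m : nat)
    (Z : {RV P >-> (n + m).-tuple X}) (k : density (density_law f)) :
  two_sample f g Z ->
  (forall A, measurable A -> density_law k A = density_law g A) ->
  forall B, measurable B ->
    distribution P Z B = density_law (sample_density n m k) B.
Proof.
move=> [indep Xf Yg] kg; apply: rectangle_eq_measure => A mA.
apply: etrans (esym (sample_density_rectangle k mA)).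
have := indep [set: 'I_(n + m)]%SET A mA.
rewrite (_ : [set w | _] = Z @^-1` rectangle A); last first.
  by apply/seteqP; split => w zA i; [exact: zA|move=> _; exact: zA].
move=> PE; refine (etrans PE _).
rewrite (eq_bigl xpredT); last by move=> i; rewrite inE.
rewrite big_split_ord /=; congr (_ * _)%E.
- by apply: eq_bigr => i _; rewrite Xf.
- by apply: eq_bigr => i _; rewrite Yg// kg.
Qed.

(** * Measurability of the sampler, the p-value and the rejection probability *)

Section measurable_rejection.
Context {d : measure_display} {X : measurableType d} {R : realType} {n m : nat}.
Variable r : posfun X R.
Local Notation tupleX := ((n + m).-tuple X).

Lemma measurable_natr d' (Y : measurableType d') (b : Y -> bool) :
  measurable_fun setT b -> measurable_fun setT (fun y => (b y)%:R : R).
Proof.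
move=> mb; rewrite (_ : (fun _ => _) = \1_(b @^-1` [set true])).
  by apply: measurable_indic; rewrite -[X in measurable X]setTI; exact: mb.
apply/funext => y; rewrite indicE; congr (nat_of_bool _)%:R.
by apply/idP/idP => [yb|/set_mem]; [rewrite inE|].
Qed.

Let mr i : measurable_fun setT (fun z : tupleX => r (tnth z i)).
Proof.
by apply: (measurableT_comp (measurable_pos_fun r)); exact: measurable_tnth.
Qed.

Lemma measurable_swap_prob s a c :
  measurable_fun setT (fun z : tupleX => swap_prob r z s a c).
Proof.
apply: measurable_funM => //.
(* On nonnegative reals, inversion is the power with exponent -1, a measurable function. *)
under eq_fun do rewrite -powR_inv1 ?addr_ge0 ?ltW ?pos_fun_gt0//.
apply: (measurableT_comp (measurable_powR _)).
exact: measurable_funD.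
Qed.

Lemma measurable_pairwise_step s t :
  measurable_fun setT (fun z : tupleX => pairwise_step r z s t).
Proof.
apply: measurable_funM => //.
under eq_fun do rewrite -big_enum/=.
apply: measurable_sum => i; under eq_fun do rewrite -big_enum/=.
apply: measurable_sum => j; apply: measurable_sum => b.
apply: measurable_funM => //; apply: measurable_prod => k _ /=.
case: (b k); first exact: measurable_swap_prob.
by apply: measurable_funB => //; exact: measurable_swap_prob.
Qed.

Lemma measurable_pairwise_sampler S s t :
  measurable_fun setT (fun z : tupleX => pairwise_sampler r z S s t).
Proof.
elim: S t => [|S ih] t //=.
by apply: measurable_sum => u; apply: measurable_funM => //; exact: measurable_pairwise_step.
Qed.

Lemma measurable_drpt_pmf H S s0 s (ss : 'I_H -> 'S_(n + m)) :
  measurable_fun setT (fun z : tupleX => drpt_pmf r z S s0 s ss).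
Proof.
apply: measurable_funM; first exact: measurable_pairwise_sampler.
by apply: measurable_prod => h _; exact: measurable_pairwise_sampler.
Qed.

Variable T : tupleX -> R.
Hypothesis mT : measurable_fun setT T.

Lemma measurable_drpt_pvalue_le H (ss : 'I_H -> 'S_(n + m)) (alpha : R) :
  measurable_fun setT (fun z => drpt_pvalue T z ss <= alpha).
Proof.
apply: measurable_fun_ler => //; apply: measurable_funM => //.
apply: measurable_funD => //; apply: measurable_sum => h.
apply: measurable_natr; apply: measurable_fun_ler => //.
by apply: (measurableT_comp mT); exact: measurable_permute.
Qed.

Lemma measurable_rejection_prob H S (alpha : R) :
  measurable_fun setT (rejection_prob (H := H) r S T alpha).
Proof.
apply: measurable_sum => s; apply: measurable_sum => ss.
apply: measurable_funM; first exact: measurable_drpt_pmf.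
by apply: measurable_natr; exact: measurable_drpt_pvalue_le.
Qed.

End measurable_rejection.

(** * The test *)

(** The rejection event is split according to the finitely many values of the hub and the resampled
    permutations. Once [ss] is fixed, rejection depends on the data only, through the set [B ss],
    and [drpt_run] gives the probability of each piece. *)
Lemma drpt_rejection_probE (R : realType) (d dO : measure_display)
    (X : measurableType d) (Omega : measurableType dO)
    (P : probability Omega R) (n m : nat) (Z : {RV P >-> (n + m).-tuple X})
    (r : posfun X R) (T : (n + m).-tuple X -> R) (S H : nat)
    (sigma_star : Omega -> 'S_(n + m)) (sigma : 'I_H -> Omega -> 'S_(n + m))
    (alpha : R) :
  measurable_fun setT T -> drpt_run Z r S 1%g sigma_star sigma ->
  P [set w | drpt_pvalue T (Z w) (fun h => sigma h w) <= alpha]%R =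
  (\int[P]_w (rejection_prob (H := H) r S T alpha (Z w))%:E)%E.
Proof.
move=> mT [ms msH run].
pose B (ss : {ffun 'I_H -> 'S_(n + m)}) :=
  [set z : (n + m).-tuple X | drpt_pvalue T z ss <= alpha].
have mB ss : measurable (B ss).
  rewrite (_ : B ss = setT `&` (fun z => drpt_pvalue T z ss <= alpha) @^-1` [set true]).
    exact: measurable_drpt_pvalue_le.
  by rewrite setTI.
pose A s (ss : {ffun 'I_H -> 'S_(n + m)}) :=
  [set w | [/\ B ss (Z w), sigma_star w = s & forall h, sigma h w = ss h]].
have mA s ss : measurable (A s ss).
  rewrite (_ : A s ss = Z @^-1` B ss `&` [set w | sigma_star w = s] `&`
      \bigcap_(h in [set: 'I_H]) [set w | sigma h w = ss h]).
    apply: measurableI; first apply: measurableI => //.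
      by rewrite -[X in measurable X]setTI; exact: measurable_funP.
    exact: fin_bigcap_measurable.
  apply/seteqP; split => w /=; first by move=> [? ? sH]; split => // h _; exact: sH.
  by move=> [[? ?] sH]; split => // h; exact: sH.
set E := [set w | _].
(* At each [w], the only term that can be nonzero is the one indexed by the realised
   permutations. *)
have indE w : \1_E w = \sum_s \sum_ss \1_(A s ss) w :> R.
  pose ss0 := [ffun h => sigma h w].
  have sg : (fun h => sigma h w) = ss0 by apply/funext => h; rewrite ffunE.
  rewrite (bigD1 (sigma_star w))//= (bigD1 ss0)//= addrAC.
  rewrite big1 ?addr0 => [|s /eqP sw]; last first.
    apply: big1 => ss _; rewrite indicE memNset// => -[_ /esym].
    by [].
  rewrite big1 ?addr0 => [|ss /eqP sw]; last first.
    rewrite indicE memNset// => -[_ _ sh]; apply: sw.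
    by apply/ffunP => h; rewrite ffunE sh.
  rewrite !indicE; congr (nat_of_bool _)%:R; apply/idP/idP; rewrite !inE /E /A /B /= sg.
    by move=> ?; split => // h; rewrite ffunE.
  by case.
have mE : measurable E.
  apply/(measurable_indicP R).
  rewrite (_ : \1_E = (fun w => \sum_s \sum_ss \1_(A s ss) w)); last exact/funext/indE.
  by apply: measurable_sum => s; apply: measurable_sum => ss; exact: measurable_indic.
rewrite -[E]setIT -integral_indic//.
under eq_integral do rewrite indE -sumEFin.
rewrite ge0_integral_sum//; last 2 first.
- by move=> s; apply/measurable_EFinP; apply: measurable_sum => ss; exact: measurable_indic.
- by move=> s w _; rewrite lee_fin sumr_ge0.
have mpmf s (ss : {ffun 'I_H -> 'S_(n + m)}) : measurable_fun setT
    (fun w => drpt_pmf r (Z w) S 1%g s ss * (drpt_pvalue T (Z w) ss <= alpha)%R%:R).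
  apply: (measurableT_comp (f := fun z : (n + m).-tuple X =>
     drpt_pmf r z S 1%g s ss * (drpt_pvalue T z ss <= alpha)%R%:R)) => //.
  apply: measurable_funM; first exact: measurable_drpt_pmf.
  by apply: measurable_natr; exact: measurable_drpt_pvalue_le.
have pmf0 s (ss : {ffun 'I_H -> 'S_(n + m)}) w :
    0 <= drpt_pmf r (Z w) S 1%g s ss * (drpt_pvalue T (Z w) ss <= alpha)%R%:R.
  by rewrite mulr_ge0// drpt_pmf_ge0//; exact: pos_fun_gt0.
rewrite /rejection_prob; under [RHS]eq_integral do rewrite -sumEFin.
rewrite ge0_integral_sum//; last 2 first.
- by move=> s; apply/measurable_EFinP; apply: measurable_sum => ss; exact: mpmf.
- by move=> s w _; rewrite lee_fin sumr_ge0.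
apply: eq_bigr => s _.
under eq_integral do rewrite -sumEFin.
rewrite ge0_integral_sum//; last by move=> ss; apply/measurable_EFinP.
under [RHS]eq_integral do rewrite -sumEFin.
rewrite ge0_integral_sum//; last 2 first.
- by move=> ss; apply/measurable_EFinP; exact: mpmf.
- by move=> ss w _; rewrite lee_fin.
apply: eq_bigr => ss _.
rewrite integral_indic// setIT; refine (etrans (run (B ss) s ss (mB ss)) _).
rewrite [LHS]integral_mkcond.
apply: eq_integral => w _; rewrite restrict_EFin/= patch_indic/= indicE.
congr (_ * (nat_of_bool _)%:R)%:E.
by apply/idP/idP => [/set_mem|wB] //; rewrite inE.
Qed.

Section validity.
Context {d : measure_display} {X : measurableType d} {R : realType}
  {mu : {measure set X -> \bar R}}.
Variables (f : density mu) (r : posfun X R).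
Hypothesis fin : (tilt_mass f r < +oo)%E.
Variables (n m : nat) (T : (n + m).-tuple X -> R).
Hypothesis mT : measurable_fun setT T.
Variables (S H : nat) (alpha : R).
Hypothesis alpha0 : 0 <= alpha.

Let q := sample_density n m (relative_tilt fin).
Let phi := rejection_prob (H := H) r S T alpha.
Let FN := product_law (density_law f) (n + m).

Let q_permute z t : q (permute z t) =
  (fine (tilt_mass f r))^-1 ^+ m * sampler_weight r z t.
Proof.
rewrite /q sample_densityE /= /relative_tilt_pdf big_split/= prodr_const card_ord.
by congr (_ * _); apply: eq_bigr => j _; rewrite tnth_permute.
Qed.

Let phi_ge0 z : 0 <= phi z.
Proof. by apply: rejection_prob_ge0; exact: pos_fun_gt0. Qed.

(** Exchangeability of the product law allows both sides to be symmetrised over all permutations.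
    The integrands are then compared at each [z] by [sum_weight_rejection_prob]. *)
Lemma integral_rejection_prob_tilt :
  (\int[FN]_z (phi z * q z)%:E <= alpha%:E)%E.
Proof.
have mphi : measurable_fun setT (fun z => phi z * q z).
  by apply: measurable_funM; [exact: measurable_rejection_prob|exact: measurable_pdf].
have h0 z : (0 <= (phi z * q z)%:E)%E by rewrite lee_fin mulr_ge0// pdf_ge0.
have mperm (h : (n + m).-tuple X -> R) (t : 'S_(n + m)) : measurable_fun setT h ->
    measurable_fun setT (fun z => (h (permute z t))%:E).
  move=> mh; apply/measurable_EFinP; apply: (measurableT_comp mh).
  exact: measurable_permute.
have N0 : (0 < #|'S_(n + m)|%:R :> R).
  by rewrite ltr0n; apply/card_gt0P; exists 1%g.
rewrite -(@lee_pmul2l _ (#|'S_(n + m)|%:R)%:E)//.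
have avg (h : (n + m).-tuple X -> R) : measurable_fun setT h -> (forall z, 0 <= h z) ->
    ((#|'S_(n + m)|%:R)%:E * \int[FN]_z (h z)%:E =
     \int[FN]_z (\sum_(t : 'S_(n + m)) h (permute z t))%:E)%E.
  move=> mh hge0; under [RHS]eq_integral do rewrite -sumEFin.
  rewrite ge0_integral_sum//; last 2 first.
  - by move=> t; exact: mperm.
  - by move=> t z _; rewrite lee_fin.
  rewrite (eq_bigr (fun=> \int[FN]_z (h z)%:E)%E) => [|t _]; last first.
    rewrite (integral_product_law_permute _ t (h := EFin \o h))//.
    exact/measurable_EFinP.
  by rewrite sumr_const mule_natl.
rewrite avg//.
(* Since [q] has mass one, [alpha] is [alpha] times its integral, which is symmetrised in the same
   way. *)
have -> : ((#|'S_(n + m)|%:R)%:E * alpha%:E =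
    \int[FN]_z (alpha * \sum_(t : 'S_(n + m)) q (permute z t))%:E)%E.
  under eq_integral do rewrite EFinM.
  rewrite ge0_integralZl//; last 2 first.
  - apply/measurable_EFinP; apply: measurable_sum => t.
    by apply/measurable_EFinP; apply: mperm; exact: measurable_pdf.
  - by move=> z _; rewrite lee_fin sumr_ge0// => t _; exact: pdf_ge0.
  rewrite -avg//; last 2 first.
  - exact: measurable_pdf.
  - exact: pdf_ge0.
  by rewrite (integral_pdf q) mule1 muleC.
apply: ge0_le_integral => //.
- by move=> z _; rewrite lee_fin sumr_ge0// => t _; rewrite -lee_fin.
- apply/measurable_EFinP; apply: measurable_sum => t.
  by apply/measurable_EFinP; apply: (mperm (fun z => phi z * q z)).
- apply/measurable_EFinP; apply: measurable_funM => //; apply: measurable_sum => t.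
  by apply/measurable_EFinP; apply: mperm; exact: measurable_pdf.
move=> z _; rewrite lee_fin.
pose c := (fine (tilt_mass f r))^-1 ^+ m.
have c0 : 0 <= c by rewrite exprn_ge0// invr_ge0 fine_ge0// ltW// tilt_mass_gt0.
rewrite [leLHS](_ : _ = c * \sum_t sampler_weight r z t * phi (permute z t)); last first.
  rewrite mulr_sumr; apply: eq_bigr => t _.
  by rewrite q_permute -/c mulrCA [phi _ * _]mulrC.
rewrite [X in alpha * X](_ : _ = c * \sum_t sampler_weight r z t); last first.
  by rewrite mulr_sumr; apply: eq_bigr => t _; rewrite q_permute.
rewrite mulrCA ler_wpM2l//.
apply: sum_weight_rejection_prob => //; exact: pos_fun_gt0.
Qed.

End validity.

Lemma TV_ge (d : measure_display) (X : measurableType d) (R : realType)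
    (P1 P2 : probability X R) (A : set X) :
  measurable A -> (P2 A <= P1 A + TV P1 P2)%E.
Proof.
move=> mA; have le : (`|P1 A - P2 A| <= TV P1 P2)%E.
  by apply: ereal_sup_ubound; exists A.
have f1 : P1 A \is a fin_num by exact: fin_num_measure.
have f2 : P2 A \is a fin_num by exact: fin_num_measure.
apply: le_trans (leeD (lexx _) le).
rewrite -(fineK f1) -(fineK f2) -EFinB abse_EFin -EFinD lee_fin.
by have := ler_norm (fine (P2 A) - fine (P1 A)); rewrite distrC; lra.
Qed.

Theorem proposition11 (R : realType)
    (d : measure_display) (X : measurableType d)
    (mu : {measure set X -> \bar R}) (f g : density mu)
    (dO : measure_display) (Omega : measurableType dO)
    (P : probability Omega R) (n m : nat) (hn : (1 <= n)%N) (hm : (1 <= m)%N)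
    (Z : {RV P >-> (n + m).-tuple X}) (hZ : two_sample f g Z)
    (Rclass : set (posfun X R)) (rstar : posfun X R) (hrstar : Rclass rstar)
    (rstar_fin : (\int[mu]_x (rstar x * f x)%:E < +oo)%E)
    (hg : {ae mu, forall x, g x = tilt f rstar rstar_fin x})
    (rhat : posfun X R)
    (rhat_fin : (\int[mu]_x (rhat x * f x)%:E < +oo)%E)
    (T : (n + m).-tuple X -> R) (hT : measurable_fun [set: (n + m).-tuple X] T)
    (S H : nat) (hS : (1 <= S)%N) (hH : (1 <= H)%N)
    (sigma_star : Omega -> 'S_(n + m)) (sigma : 'I_H -> Omega -> 'S_(n + m))
    (hrun : drpt_run Z rhat S 1%g sigma_star sigma)
    (alpha : R) (halpha : 0 <= alpha <= 1) :
  (P [set w | drpt_pvalue T (Z w) (fun h => sigma h w) <= alpha]%R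
   <= alpha%:E
      + TV (product_law (density_law (tilt f rhat rhat_fin)) m)
           (product_law (density_law (tilt f rstar rstar_fin)) m))%E.
Proof.
have /andP[alpha0 _] := halpha.
have rhat_gt0 := pos_fun_gt0 rhat.
pose FN := product_law (density_law f) (n + m).
pose ks := relative_tilt (rstar_fin : (tilt_mass f rstar < +oo)%E).
pose kh := relative_tilt (rhat_fin : (tilt_mass f rhat < +oo)%E).
pose p := sample_density n m ks.
pose q := sample_density n m kh.
pose phi := rejection_prob (H := H) rhat S T alpha.
have mphi : measurable_fun setT phi by exact: measurable_rejection_prob.
have phi0 z : 0 <= phi z by exact: rejection_prob_ge0.
have phi1 z : phi z <= 1 by exact: rejection_prob_le1.
have mp : measurable_fun setT p by exact: measurable_pdf.
have mq : measurable_fun setT q by exact: measurable_pdf.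
have p0 z : 0 <= p z by exact: pdf_ge0.
have q0 z : 0 <= q z by exact: pdf_ge0.
(* Proportionality holds [mu]-almost everywhere, which is enough for equality of the laws. *)
have ksg A : measurable A -> density_law ks A = density_law g A.
  move=> mA; rewrite relative_tilt_law//; apply: ae_eq_integral => //.
  - by apply/measurable_EFinP; apply: measurable_funTS; exact: measurable_pdf.
  - by apply/measurable_EFinP; apply: measurable_funTS; exact: measurable_pdf.
  - by apply: filterS hg => x /= -> _.
(* The set where [p] exceeds [q] is described by the last [m] coordinates, so that its probabilities
   are those of the [m]-fold products in the total variation. *)
pose D' : set (m.-tuple X) :=
  [set y | \prod_(j < m) kh (tnth y j) < \prod_(j < m) ks (tnth y j)].
have mD' : measurable D'.
  rewrite (_ : D' = setT `&` (fun y : m.-tuple X =>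
    \prod_(j < m) kh (tnth y j) < \prod_(j < m) ks (tnth y j)) @^-1` [set true]);
    last by rewrite setTI.
  apply: measurable_fun_ltr => //.
  - by apply: (@measurable_prod_tnth _ _ _ m (fun=> kh)) => j; exact: measurable_pdf.
  - by apply: (@measurable_prod_tnth _ _ _ m (fun=> ks)) => j; exact: measurable_pdf.
pose D : set ((n + m).-tuple X) := @last_coords _ _ n m @^-1` D'.
have mD : measurable D.
  by rewrite -[X in measurable X]setTI; exact: measurable_last_coords.
have DE z : D z = (q z < p z) :> Prop.
  rewrite /D /p /q !sample_densityE /preimage /D' /mkset.
  by congr (is_true (_ < _)); apply: eq_bigr => j _; rewrite tnth_mktuple.
have lawD (k : density (density_law f)) :
    (\int[FN]_z (\1_D z * sample_density n m k z)%:E =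
     density_law (sample_density n m k) D)%E.
  rewrite -[in RHS](setIT D) -integral_indic// integral_density_law//.
  by apply/measurable_EFinP.
rewrite (drpt_rejection_probE alpha hT hrun).
have -> : (\int[P]_w (phi (Z w))%:E = \int[FN]_z (phi z * p z)%:E)%E.
  rewrite -(ge0_integral_distribution Z (f := EFin \o phi))//; last first.
    exact/measurable_EFinP.
  rewrite (eq_measure_integral (density_law p)); last first.
    by move=> A mA _; exact: (two_sample_law hZ ksg).
  by rewrite integral_density_law//; exact/measurable_EFinP.
(* Stated with sums on both sides, so no difference of extended reals occurs. At each [z] the
   inequality amounts to [(1 - phi z) * (p z - q z) >= 0] on [D] and to [phi z * (q z - p z) >= 0]
   off [D]. *)
have key : (\int[FN]_z (phi z * p z)%:E + density_law q D <=
            \int[FN]_z (phi z * q z)%:E + density_law p D)%E.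
  rewrite -!lawD -!ge0_integralD//; last 8 first.
  all: try by move=> z _; rewrite lee_fin mulr_ge0.
  all: try by apply/measurable_EFinP; exact: measurable_funM.
  apply: ge0_le_integral => //.
  - by move=> z _; rewrite -EFinD lee_fin addr_ge0// mulr_ge0.
  - by apply/measurable_EFinP; apply: measurable_funD; exact: measurable_funM.
  - by apply/measurable_EFinP; apply: measurable_funD; exact: measurable_funM.
  move=> z _; rewrite -!EFinD lee_fin indicE.
  have [zD|zD] := boolP (z \in D).
    have : q z < p z by rewrite -DE; exact: set_mem.
    by rewrite mulr1n; have := phi1 z; nra.
  have : p z <= q z by rewrite leNgt; apply/negP; rewrite -DE => Dz; move: zD; rewrite mem_set.
  by rewrite mulr0n; have := phi0 z; nra.
have qD : density_law q D =
    product_law (density_law (tilt f rhat rhat_fin)) m D'.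
  by apply: sample_density_marginal => // A mA; exact: relative_tilt_law.
have pD : density_law p D =
    product_law (density_law (tilt f rstar rstar_fin)) m D'.
  by apply: sample_density_marginal => // A mA; exact: relative_tilt_law.
have TVD := TV_ge (product_law (density_law (tilt f rhat rhat_fin)) m)
  (product_law (density_law (tilt f rstar rstar_fin)) m) mD'.
have qD_fin : density_law q D \is a fin_num by exact: fin_num_measure.
(* Adding the finite quantity [density_law q D] to both sides brings the goal to the form of [key];
   it remains to add the bound for the tilted law and the total variation bound on [D']. *)
rewrite -(leeD2rE _ _ qD_fin); apply: (le_trans key).
have := integral_rejection_prob_tilt (rhat_fin : (tilt_mass f rhat < +oo)%E)
  hT S H alpha0.
move=> /leeD /(_ TVD); rewrite -pD -qD => /le_trans; apply.
by rewrite addeA addeAC.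
Qed.
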